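(* Let $A$ be a finite set and $\varphi\colon A^\omega\to\mathbb{R}$ be a continuous payoff. Then $\varphi$ is positionally determined in MDPs if and only if $\varphi$ is multi-discounted.
   Context: $A^\omega$ denotes the set of infinite words over $A$. A payoff is a bounded function $A^\omega\to\mathbb{R}$. Continuity is with respect to the product topology on $A^\omega$ of the discrete topology on $A$. A payoff $\varphi\colon A^\omega\to\mathbb{R}$ is multi-discounted if there are functions $\lambda\colon A\to[0,1)$ and $w\colon A\to\mathbb{R}$ such that $\varphi(a_1a_2a_3\ldots)=\sum_{n=1}^\infty\lambda(a_1)\cdot\ldots\cdot\lambda(a_{n-1})\cdot w(a_n)$ for all $a_1a_2a_3\ldots\in A^\omega$. MDPs. $\Delta(S)$ is the set of probability distributions over a finite set $S$. An $A$-labeled MDP is a tuple $\mathcal{M}=\langle S,\mathsf{Act},\mathsf{lab}\rangle$, where $S$ is a finite set of states, $\mathsf{Act}\subseteq S\times\Delta(S)$ is a finite set of actions, $\mathsf{lab}\colon\mathsf{Act}\times S\to A$ is the labeling function, and for every $s\in S$ there is $P\in\Delta(S)$ with $(s,P)\in\mathsf{Act}$. For $e=(s,P)\in\mathsf{Act}$ put $\mathsf{source}(e)=s$ and $\mathrm{Dist}[e]=P$. Elements of $T=\mathsf{Act}\times S$ are transitions. A history is a non-empty finite or infinite sequence $h=(e_1,s_1)(e_2,s_2)\ldots$ of transitions with $s_{i-1}=\mathsf{source}(e_i)$ for all $i\ge 2$; put $\mathsf{source}(h)=\mathsf{source}(e_1)$ and, if $h$ is finite, $\mathsf{target}(h)=s_{|h|}$.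 In addition, for each $s\in S$ there is a $0$-length history $\lambda_s$ with source and target $s$. A strategy $\sigma$ assigns to every finite history $h$ (including $0$-length ones) an action $\sigma(h)$ with $\mathsf{source}(\sigma(h))=\mathsf{target}(h)$. Given $s\in S$ and a strategy $\sigma$, $\mathcal{P}^\sigma_s$ is the unique Borel probability measure on $T^\omega$ (product topology) with $\mathcal{P}^\sigma_s(hT^\omega)=P^\sigma_s(h)$ for all $h\in T^*$, where $P^\sigma_s$ is $1$ on the empty word (identified with $\lambda_s$), and for $h=(e_1,s_1)\ldots(e_{n+1},s_{n+1})$, $n\ge 0$: $P^\sigma_s(h)=P^\sigma_s((e_1,s_1)\ldots(e_n,s_n))\cdot\mathrm{Dist}[e_{n+1}](s_{n+1})$ if $h$ is a history with $\mathsf{source}(h)=s$ and $e_{n+1}=\sigma((e_1,s_1)\ldots(e_n,s_n))$ (read as $\sigma(\lambda_s)$ when $n=0$), and $P^\sigma_s(h)=0$ otherwise. The labeling extends to infinite sequences of transitions letter by letter, and $\mathbb{E}[\varphi\circ\mathsf{lab}(\mathcal{P}^\sigma_s)]$ denotes $\mathbb{E}_{\mathcal{H}\sim\mathcal{P}^\sigma_s}[\varphi(\mathsf{lab}(\mathcal{H}))]$. A strategy $\sigma$ is optimal if $\mathbb{E}[\varphi\circ\mathsf{lab}(\mathcal{P}^\sigma_s)]\ge\mathbb{E}[\varphi\circ\mathsf{lab}(\mathcal{P}^{\sigma'}_s)]$ for every strategy $\sigma'$ and every state $s$. A strategy $\sigma$ is positional if $\mathsf{target}(h_1)=\mathsf{target}(h_2)\implies\sigma(h_1)=\sigma(h_2)$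 for all finite histories $h_1,h_2$. A bounded measurable payoff $\varphi$ is positionally determined in MDPs if every $A$-labeled MDP has an optimal positional strategy w.r.t. $\varphi$. *)

(* Defs.v *)
From HB Require Import structures.
From mathcomp Require Import all_boot all_order all_algebra.
From mathcomp Require Import finmap.
From mathcomp Require Import all_classical all_reals all_analysis.

Set Implicit Arguments.
Unset Strict Implicit.
Unset Printing Implicit Defensive.

Import Order.TTheory GRing.Theory Num.Theory.
Import numFieldNormedType.Exports.

Local Open Scope classical_set_scope.
Local Open Scope ring_scope.

Definition word (A : choiceType) : Type := {ptws nat -> discrete_topology A}.
HB.instance Definition _ (A : choiceType) := Topological.on (word A).

(* The letters [a_1 a_2 a_3 ...] of a word are indexed from [0] here. *)
Definition multi_discounted (R : realType) (A : finType) (phi : word A -> R) :=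
  exists lambda w : A -> R, (forall a, 0 <= lambda a < 1) /\
    forall x : word A,
      series (fun n => (\prod_(i < n) lambda (x i)) * w (x n)) @ \oo --> phi x.

(* [A^omega] with a distinguished word, because measurable types are pointed
   in the library; nothing below depends on the choice of [t0]. *)
Definition pword (T : choiceType) (t0 : T) : Type := word T.
HB.instance Definition _ (T : choiceType) (t0 : T) := Topological.on (pword t0).
HB.instance Definition _ (T : choiceType) (t0 : T) :=
  isPointed.Build (pword t0) (fun=> t0).

Definition borel_word (T : choiceType) (t0 : T) :=
  g_sigma_algebraType (@open (pword t0)).
HB.instance Definition _ (T : choiceType) (t0 : T) :=
  Measurable.on (borel_word t0).

(* the set [h T^omega] *)
Definition cylinder (T : Type) (h : seq T) : set (nat -> T) :=
  [set x | mkseq x (size h) = h].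

Section Words.
Variables (T : finType).
Implicit Types (h : seq T) (x : nat -> T) (t : T).

Lemma cylinderP h x : reflect (cylinder h x) (mkseq x (size h) == h).
Proof. exact: eqP. Qed.

Lemma cylinder_rcons h t x :
  cylinder (rcons h t) x <-> cylinder h x /\ x (size h) = t.
Proof.
rewrite /cylinder /mkset size_rcons mkseqS; split => [/rcons_inj[]//|[-> ->//]].
Qed.

Lemma cylinder_mkseq x n : cylinder (mkseq x n) x.
Proof. by rewrite /cylinder /= size_mkseq. Qed.

Lemma cylinder_mkseqP x y n :
  cylinder (mkseq x n) y <-> forall i, (i < n)%N -> y i = x i.
Proof.
rewrite /cylinder /mkset size_mkseq; split=> [e i i_n|e].
  by rewrite -(nth_mkseq (x i) y i_n) e nth_mkseq.
apply: (@eq_from_nth _ (x 0%N)); rewrite !size_mkseq // => i i_n.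
by rewrite !nth_mkseq ?e.
Qed.

Lemma cylinder_take h x n : cylinder h x -> cylinder (take n h) x.
Proof.
rewrite /cylinder /= => hx; rewrite -{2}hx /mkseq -map_take take_iota.
by rewrite size_take_min.
Qed.

Lemma cylinderI h1 h2 : (size h1 <= size h2)%N ->
  cylinder h1 `&` cylinder h2 = set0 \/ cylinder h1 `&` cylinder h2 = cylinder h2.
Proof.
move=> h12; have [e|ne] := eqVneq (take (size h1) h2) h1.
  right; apply/seteqP; split => [x []//|x h2x]; split => //.
  by rewrite -e; exact: cylinder_take.
left; apply/seteqP; split => // x [h1x /cylinder_take-/(_ (size h1))].
rewrite /cylinder/= size_takel// => e; move: ne; rewrite -e.
by rewrite (h1x : mkseq x (size h1) = h1) eqxx.
Qed.

Lemma cylinder_nbhs x n : nbhs (x : word T) (cylinder (mkseq x n)).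
Proof.
elim: n => [|n IHn].
  by apply: filterS filterT => y _; rewrite /cylinder /= .
have cont : {for (x : word T), continuous (fun y : word T => (y n : discrete_topology T))}.
  exact: (@proj_continuous nat (fun=> discrete_topology T) n).
have /cont /= xn := @discrete_set1 (discrete_topology T) (x n).
apply: filterS (filterI IHn xn) => y [yn /= eyn].
by rewrite mkseqS; apply/cylinder_rcons; split => //; rewrite size_mkseq.
Qed.

Lemma nbhs_cylinder x (U : set (word T)) :
  nbhs (x : word T) U -> exists n, cylinder (mkseq x n) `<=` U.
Proof.
pose F := filter_from setT (fun n => cylinder (mkseq x n) : set (word T)).
have sub m n : (m <= n)%N -> cylinder (mkseq x n) `<=` cylinder (mkseq x m).
  move=> mn y /(@cylinder_take _ _ m).
  by rewrite /mkseq -map_take take_iota (minn_idPl mn).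
have FF : Filter F.
  apply: filter_from_filter; first by exists 0%N.
  move=> i j _ _; exists (maxn i j) => // y yij; split.
    by apply: (sub _ _ _ _ yij); rewrite leq_maxl.
  by apply: (sub _ _ _ _ yij); rewrite leq_maxr.
have cvF : F --> (x : word T).
  apply/cvg_sup => i U' [V [[W oW <-] Wxi WU]].
  by exists i.+1 => // y /cylinder_mkseqP yx; apply: WU; rewrite /= yx.
by move=> /cvF[n _ nU]; exists n.
Qed.

End Words.

Section Borel.
Variables (T : finType) (t0 : T).

Definition cylinders : set (set (pword t0)) :=
  [set A | A = set0 \/ exists h : seq T, A = cylinder h].

Lemma open_cylinder (h : seq T) : open (cylinder h : set (pword t0)).
Proof.
rewrite openE => x hx; have <- : mkseq x (size h) = h by [].
exact: cylinder_nbhs.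
Qed.

Lemma setI_closed_cylinders : setI_closed cylinders.
Proof.
move=> A B [->|[h1 ->]]; first by rewrite set0I; left.
case=> [->|[h2 ->]]; first by rewrite setI0; left.
wlog h12 : h1 h2 / (size h1 <= size h2)%N => [hw|].
  by have [/hw//|/ltnW/hw] := leqP (size h1) (size h2); rewrite setIC.
by have [->|->] := cylinderI h12; [left|right; exists h2].
Qed.

Lemma measurable_borel_word :
  measurable = <<s cylinders >> :> set (set (borel_word t0)).
Proof.
apply/seteqP; split.
  apply: smallest_sub; first exact: smallest_sigma_algebra.
  move=> U oU.
  pose C n : set (pword t0) := if (choice.unpickle n : option (seq T)) is Some h then
    (if `[< cylinder h `<=` U >] then cylinder h else set0) else set0.
  have -> : U = \bigcup_n C n.
    apply/seteqP; split => [x Ux|x [n _]]; last first.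
      by rewrite /C; case: choice.unpickle => // h; case: asboolP => // hU /hU.
    have := oU; rewrite openE => /(_ _ Ux) /nbhs_cylinder[n nU].
    exists (choice.pickle (mkseq x n)) => //; rewrite /C choice.pickleK asboolT //.
    exact: cylinder_mkseq.
  apply: sigma_algebra_bigcup => n; apply: sub_sigma_algebra; rewrite /C.
  case: choice.unpickle => [h|]; last by left.
  by case: ifP => _; [right; exists h|left].
apply: smallest_sub; first exact: sigma_algebra_measurable.
move=> A [->|[h ->]]; first exact: measurable0.
by apply: sub_sigma_algebra; exact: open_cylinder.
Qed.

Lemma measurable_cylinder (h : seq T) :
  measurable (cylinder h : set (borel_word t0)).
Proof. by apply: sub_sigma_algebra; exact: open_cylinder. Qed.

Lemma probability_cylinder_unique (R : realType)
    (P Q : probability (borel_word t0) R) :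
  (forall h : seq T, P (cylinder h) = Q (cylinder h)) ->
  forall B, measurable B -> P B = Q B.
Proof.
move=> PQ B mB.
apply: (@measure_unique _ R (borel_word t0) cylinders
  (fun=> cylinder ([::] : seq T)) _ _ _ _ P Q) => //.
- exact: measurable_borel_word.
- exact: setI_closed_cylinders.
- by move=> _; right; exists [::].
- by apply/seteqP; split => // x _; exists 0%N.
- by move=> A [->|[h ->]]; [rewrite !measure0|exact: PQ].
- move=> _; apply: (@le_lt_trans _ _ 1%E); last exact: ltry.
  by apply: probability_le1; exact: (measurable_cylinder [::]).
Qed.

End Borel.

(* Any consistent assignment [p] of masses to cylinders comes from a probability
   measure: each [h] gets the interval [low h, low h + p h[ of [0, 1[, the
   intervals of the words [rcons h t] partition that of [h], and the Lebesgue
   measure is transported by the map sending [x] to the word whose prefixes are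
   the [h] with [x] in the interval of [h]. *)
Section Existence.
Variables (R : realType) (T : finType) (t0 : T) (p : seq T -> R).
Hypotheses (p_nil : p [::] = 1) (p_ge0 : forall h, 0 <= p h)
  (p_rcons : forall h, \sum_t p (rcons h t) = p h).

Let c h n := \sum_(u : T | (enum_rank u < n)%N) p (rcons h u).

Let c_mono h m n : (m <= n)%N -> c h m <= c h n.
Proof.
move=> mn; rewrite /c big_mkcond [leRHS]big_mkcond /=; apply: ler_sum => u _.
case: ifP => um; first by rewrite (leq_trans um mn).
by case: ifP.
Qed.

Let cS h t : c h (enum_rank t).+1 = c h (enum_rank t) + p (rcons h t).
Proof.
rewrite /c (bigD1 t) //= addrC; congr (_ + _); apply: eq_bigl => u.
by rewrite ltnS leq_eqVlt -(inj_eq enum_rank_inj) andb_orl andbN /=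
  -(inj_eq val_inj) /= andb_idr // => /ltn_eqF ->.
Qed.

Let c0 h : c h 0 = 0. Proof. by rewrite /c big_pred0. Qed.

Let cT h : c h #|T| = p h.
Proof. by rewrite /c -p_rcons; apply: eq_bigl => u; rewrite ltn_ord. Qed.

Let c_ge0 h n : 0 <= c h n. Proof. by rewrite -(c0 h) c_mono. Qed.

Let c_le h t : c h (enum_rank t) + p (rcons h t) <= p h.
Proof. by rewrite -cS -(cT h) c_mono. Qed.

Fixpoint low_rev (r : seq T) : R :=
  if r is t :: r' then low_rev r' + c (rev r') (enum_rank t) else 0.
Let low h := low_rev (rev h).

Let low_rcons h t : low (rcons h t) = low h + c h (enum_rank t).
Proof. by rewrite /low rev_rcons /= revK. Qed.

Let I h x := low h <= x < low h + p h.

Let I_rcons h t x : I (rcons h t) x -> I h x.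
Proof.
rewrite /I low_rcons => /andP[lx xl]; apply/andP; split.
  by apply: le_trans lx; rewrite lerDl.
by apply: (lt_le_trans xl); rewrite -addrA lerD2l.
Qed.

Let I_ex h x : I h x -> exists t, I (rcons h t) x.
Proof.
move=> /andP[lx xl].
have ex : exists n, x < low h + c h n by exists #|T|; rewrite cT.
case: (ex_minnP ex) => -[|n]; first by rewrite c0 addr0 ltNge lx.
move=> xn nmin.
have nx : low h + c h n <= x.
  by rewrite leNgt; apply/negP => /nmin; rewrite ltnn.
have nT : (n < #|T|)%N.
  by apply: nmin; rewrite cT.
exists (enum_val (Ordinal nT)); rewrite /I low_rcons enum_valK nx /=.
by rewrite -addrA -[X in _ + (c _ X + _)](congr1 val (enum_valK (Ordinal nT)))
  -cS enum_valK.
Qed.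

Let I_uniq h t u x : I (rcons h t) x -> I (rcons h u) x -> t = u.
Proof.
wlog tu : t u / (enum_rank t <= enum_rank u)%N => [hw It Iu|].
  have [tu|/ltnW ut] := leqP (enum_rank t) (enum_rank u); first exact: hw.
  by apply/esym/hw.
rewrite /I !low_rcons => /andP[_ xt] /andP[ux _].
move: tu; rewrite leq_eqVlt => /orP[/eqP/val_inj/enum_rank_inj//|tu].
move: (le_lt_trans ux xt); rewrite -addrA ltrD2l -cS ltNge.
by rewrite c_mono.
Qed.

Let next h x := odflt t0 [pick t | I (rcons h t) x].

Let nextP h x t : I (rcons h t) x -> next h x = t.
Proof.
rewrite /next; case: pickP => [u uI tI|/(_ t)/= -> //]; exact: (I_uniq uI tI).
Qed.

Fixpoint prefix_at (x : R) n : seq T :=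
  if n is m.+1 then rcons (prefix_at x m) (next (prefix_at x m) x) else [::].
Let f x : pword t0 := fun n => next (prefix_at x n) x.

Let mkseqf x n : mkseq (f x) n = prefix_at x n.
Proof.
by elim: n => [//|n IHn]; rewrite mkseqS IHn.
Qed.

Let size_prefix x n : size (prefix_at x n) = n.
Proof. by rewrite -mkseqf size_mkseq. Qed.

Let f_cylinder h x : I [::] x -> cylinder h (f x) <-> I h x.
Proof.
move=> x01; elim/last_ind: h => [|h t IHh]; first by split.
split=> [/cylinder_rcons[/[dup] hx /IHh /I_ex[u Iu]]|It].
  by rewrite /f -mkseqf (hx : mkseq _ _ = h) (nextP Iu) => <-.
have Ih := I_rcons It; apply/cylinder_rcons; have hx := IHh.2 Ih; split => //.
by rewrite /f -mkseqf (hx : mkseq _ _ = h) (nextP It).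
Qed.

Let D : set R := `[0, 1[%classic.

Let ID x : I [::] x = (x \in `[0, 1[).
Proof. by rewrite /I /low /= p_nil add0r in_itv. Qed.

Let g x : borel_word t0 := if x \in `[0, 1[ then f x else fun=> t0.

Let I_sub h x : I h x -> I [::] x.
Proof. by elim/last_ind: h => // h t IHh /I_rcons. Qed.

Let gE x : I [::] x -> g x = f x. Proof. by rewrite ID /g => ->. Qed.

Let gN x : ~ D x -> g x = fun=> t0.
Proof. by rewrite /g; case: ifPn. Qed.

Let g_cylinder h : g @^-1` cylinder h `&` D = `[low h, low h + p h[%classic.
Proof.
apply/seteqP; split => x.
  case=> + xD; have x0 : I [::] x by rewrite ID.
  by rewrite /preimage /mkset gE // => /(f_cylinder h x0); rewrite in_itv.
rewrite /mkset in_itv => hx; have x0 := I_sub (hx : I h x); split.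
  by rewrite /preimage /mkset gE //; apply/(f_cylinder h x0).
by rewrite /D /mkset -ID.
Qed.

Let g_measurable : measurable_fun (setT : set (measurableTypeR R)) g.
Proof.
apply: (@measurability _ _ (measurableTypeR R) (borel_word t0) setT g
  (@cylinders T t0)); first exact: measurable_borel_word.
move=> _ [A [->|[h ->]] <-].
  by rewrite preimage_set0 setI0; exact: measurable0.
have mD : measurable D by exact: measurable_itv.
have -> : [set: R] `&` g @^-1` cylinder h =
    `[low h, low h + p h[%classic `|` (~` D `&` (fun=> cylinder h (fun=> t0))).
  rewrite setTI -g_cylinder -[LHS](setIT) -[in LHS](setUv D) setIUr.
  congr (_ `|` _); rewrite setIC; apply/seteqP.
  by split=> x [xD hx]; split => //; move: hx; rewrite /preimage /mkset gN.
apply: measurableU; first exact: measurable_itv.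
apply: measurableI; first exact: measurableC.
have [ht0|ht0] := pselect (cylinder h (fun=> t0)).
  by rewrite (_ : (fun=> _) = setT) //; apply/seteqP; split.
rewrite (_ : (fun=> _) = set0) //; apply/seteqP; split => // x /ht0.
Qed.

Let lebD : mrestr lebesgue_measure (measurable_itv `[0, 1[) setT = 1%E
  :> \bar R.
Proof.
by rewrite /mrestr setTI lebesgue_measure_itv /= lte_fin ltr01 oppr0 adde0.
Qed.

Lemma word_measure_exists : exists P : probability (borel_word t0) R,
  forall h, P (cylinder h) = (p h)%:E.
Proof.
pose g' : {mfun measurableTypeR R >-> borel_word t0} :=
  HB.pack g (@isMeasurableFun.Build _ _
    (measurableTypeR R) (borel_word t0) g g_measurable).
pose m : {measure set (measurableTypeR R) -> \bar R} :=
   mrestr lebesgue_measure (measurable_itv `[0, 1[).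
pose P : probability (measurableTypeR R) R :=
  HB.pack (Measure.sort m) (Measure_isProbability.Build _ _ _ m lebD).
exists (distribution P g') => h.
transitivity (lebesgue_measure (g @^-1` cylinder h `&` D)); first by [].
rewrite g_cylinder lebesgue_measure_itv /= lte_fin ltrDl.
have := p_ge0 h; rewrite le0r => /orP[/eqP -> |ph]; first by rewrite ltxx.
by rewrite ph -EFinB addrAC subrr add0r.
Qed.

End Existence.

Definition is_dist (R : realType) (S : finType) (P : {ffun S -> R}) : bool :=
  [forall s, 0 <= P s] && (\sum_s P s == 1).

Definition dist (R : realType) (S : finType) : Type :=
  {P : {ffun S -> R} | is_dist P}.
HB.instance Definition _ (R : realType) (S : finType) :=
  Choice.copy (dist R S) {P : {ffun S -> R} | is_dist P}.

Record mdp (R : realType) (A : Type) := MDP {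
  state : finType;
  act : {fset state * dist R state};
  lab : act * state -> A;
  act_total : forall s, exists P, (s, P) \in act }.

Section MDP.
Variables (R : realType) (A : Type) (M : mdp R A).

Definition transition : finType := (act M * state M)%type.

Definition source (e : act M) : state M := (val e).1.
Definition Dist (e : act M) : {ffun state M -> R} := val (val e).2.

Definition is_history (s : state M) (h : seq transition) : bool :=
  if h is t :: h' then
    (source t.1 == s) && path (fun t u => t.2 == source u.1) t h'
  else true.

(* Finite histories paired with their source; [(s, [::])] is [lambda_s], and
   for nonempty histories the source component carries no information. *)
Definition history : Type :=
  {h : state M * seq transition | is_history h.1 h.2}.
HB.instance Definition _ := Choice.copy history
  {h : state M * seq transition | is_history h.1 h.2}.

Definition target (h : history) : state M :=
  last (val h).1 [seq t.2 | t <- (val h).2].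

Record strategy := Strategy {
  play :> history -> act M;
  source_play : forall h, source (play h) = target h }.

Definition positional (sigma : strategy) : Prop :=
  forall h1 h2, target h1 = target h2 -> sigma h1 = sigma h2.

(* [P^sigma_s (h t) = P^sigma_s (h) * step_prob h t] *)
Definition step_prob (sigma : strategy) (s : state M) (h : seq transition)
    (t : transition) : R :=
  if (insub (s, h) : option history) is Some h' then
    if is_history s (rcons h t) && (t.1 == sigma h') then Dist t.1 t.2 else 0
  else 0.

Fixpoint word_prob_rev (sigma : strategy) (s : state M) (r : seq transition) : R :=
  if r is t :: r' then word_prob_rev sigma s r' * step_prob sigma s (rev r') t
  else 1.

Definition word_prob (sigma : strategy) (s : state M) (h : seq transition) : R :=
  word_prob_rev sigma s (rev h).

Lemma word_prob_nil sigma s : word_prob sigma s [::] = 1.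
Proof. by []. Qed.

Lemma word_prob_rcons sigma s h t :
  word_prob sigma s (rcons h t) = word_prob sigma s h * step_prob sigma s h t.
Proof. by rewrite /word_prob rev_rcons /= revK. Qed.

Lemma Dist_ge0 e s : 0 <= Dist e s.
Proof. by rewrite /Dist; case: (val e).2 => P /= /andP[/forallP]. Qed.

Lemma sum_Dist e : \sum_s Dist e s = 1.
Proof. by rewrite /Dist; case: (val e).2 => P /= /andP[_ /eqP]. Qed.

Lemma word_prob_ge0 sigma s h : 0 <= word_prob sigma s h.
Proof.
elim/last_ind: h => [|h t IHh]; first by rewrite word_prob_nil.
rewrite word_prob_rcons mulr_ge0 // /step_prob; case: insub => // h'.
by case: ifP => _ //; exact: Dist_ge0.
Qed.

Lemma is_history_rcons s h t : is_history s (rcons h t) =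
  is_history s h && (last s [seq u.2 | u <- h] == source t.1).
Proof.
case: h => [|u h] /=; first by rewrite andbT eq_sym.
by rewrite rcons_path -andbA last_map.
Qed.

Lemma word_prob_eq0 sigma s h : ~~ is_history s h -> word_prob sigma s h = 0.
Proof.
elim/last_ind: h => [//|h t _] /negbTE ht.
by rewrite word_prob_rcons /step_prob ht; case: insub => *; rewrite mulr0.
Qed.

Lemma sum_word_prob sigma s h :
  \sum_t word_prob sigma s (rcons h t) = word_prob sigma s h.
Proof.
under eq_bigr do rewrite word_prob_rcons.
rewrite -mulr_sumr; have [hs|/word_prob_eq0 ->] := boolP (is_history s h);
  last by rewrite mul0r.
rewrite -[RHS]mulr1; congr (_ * _).
pose h' : history := Sub (s, h) (hs : is_history (s, h).1 (s, h).2).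
have stepE t : step_prob sigma s h t =
    if t.1 == sigma h' then Dist t.1 t.2 else 0.
  rewrite /step_prob
    (@insubT _ (fun h => is_history h.1 h.2) history (s, h) hs) -/h'.
  rewrite is_history_rcons hs /=.
  have [->|] := eqVneq t.1 (sigma h'); last by rewrite andbF.
  by rewrite andbT source_play eqxx.
under eq_bigr do rewrite stepE.
rewrite -(pair_bigA _
  (fun e s' => if e == sigma h' then Dist e s' else 0 : R)) /=.
rewrite (bigD1 (sigma h')) //= [X in _ + X]big1 => [|e /negbTE ne]; last first.
  by rewrite big1 // => s' _; rewrite ne.
rewrite addr0; under eq_bigr do rewrite eqxx.
exact: sum_Dist.
Qed.

Definition some_transition (s : state M) : transition :=
  ([` xchooseP (act_total s)]%fset, s).

Lemma path_measure_exists sigma s :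
  exists P : probability (borel_word (some_transition s)) R,
    forall h, P (cylinder h) = (word_prob sigma s h)%:E.
Proof.
apply: word_measure_exists => [|h|h].
- exact: word_prob_nil.
- exact: word_prob_ge0.
- exact: sum_word_prob.
Qed.

(* The measure [P^sigma_s]; it is characterized by [path_measureE] and
   [path_measure_unique] below. *)
Definition path_measure sigma s : probability (borel_word (some_transition s)) R :=
  projT1 (cid (path_measure_exists sigma s)).

Lemma path_measureE sigma s h :
  path_measure sigma s (cylinder h) = (word_prob sigma s h)%:E.
Proof. exact: (projT2 (cid (path_measure_exists sigma s))). Qed.

Lemma path_measure_unique sigma s
    (P : probability (borel_word (some_transition s)) R) :
  (forall h, P (cylinder h) = (word_prob sigma s h)%:E) ->
  forall B, measurable B -> P B = path_measure sigma s B.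
Proof.
by move=> PE; apply: probability_cylinder_unique => h; rewrite PE path_measureE.
Qed.

End MDP.

Section Determinacy.
Variables (R : realType) (A : choiceType) (phi : word A -> R).
Local Open Scope ereal_scope.

Definition expected_payoff (M : mdp R A) (sigma : strategy M) (s : state M) :
    \bar R :=
  'E_(path_measure sigma s)[fun H => phi (fun n => lab (H n))].

Definition optimal (M : mdp R A) (sigma : strategy M) : Prop :=
  forall (sigma' : strategy M) (s : state M),
    expected_payoff sigma' s <= expected_payoff sigma s.

(* For bounded measurable [phi]; otherwise the expectation is a junk value. *)
Definition positionally_determined : Prop :=
  forall M : mdp R A, exists sigma : strategy M, positional sigma /\ optimal sigma.

End Determinacy.

(* Main.v *)
(* A bounded payoff is multi-discounted iff [phi (a x) = w a + lambda a * phi x]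
   for some [w] and [0 <= lambda < 1].

   If this holds, a fixed point [V] of the Bellman operator exists by
   monotonicity alone, and discounting [V] at the end of a finite history gives
   a supermartingale under every strategy, which is a martingale under the
   positional greedy strategy; its limit is the payoff.

   Conversely, in an MDP where a state offering a choice between two lotteries
   over words can be entered after the empty history or after a letter [a],
   positional determinacy forbids the two strict preferences to be opposite.
   As functions on lotteries, [phi] and [phi (a _)] are affine, so [phi (a _)]
   is an affine function of [phi] with slope [lambda a >= 0]. Finally
   [lambda a ^+ n * (phi y - phi x) = phi (a^n y) - phi (a^n x)] tends to [0] by
   continuity at the word [a a a ...], hence [lambda a < 1]. *)
Require Import Defs.
From HB Require Import structures.
From mathcomp Require Import all_boot all_order all_algebra.
From mathcomp Require Import finmap zify ring.
From mathcomp Require Import all_classical all_reals all_analysis.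
From mathcomp Require Import measurable_realfun.

Set Implicit Arguments.
Unset Strict Implicit.
Unset Printing Implicit Defensive.

Import Order.TTheory GRing.Theory Num.Theory.
Import numFieldNormedType.Exports.
Local Open Scope classical_set_scope.
Local Open Scope ring_scope.

(** * Expectations of limits of functions of prefixes *)

Fixpoint words (T : finType) n : seq (seq T) :=
  if n is m.+1 then [seq rcons h t | h <- words T m, t <- enum T]
  else [:: [::]].

Lemma big_wordsS (R : nmodType) (T : finType) n (F : seq T -> R) :
  \sum_(h <- words T n.+1) F h = \sum_(h <- words T n) \sum_t F (rcons h t).
Proof.
by rewrite big_allpairs_dep; apply: eq_bigr => h _; rewrite big_enum.
Qed.

(** The cylinders of the words of length [n] partition the space, so one term survives; a function
    of a prefix becomes a simple function. *)
Lemma sum_words_cylinder (R : pzRingType) (T : finType) n (F : seq T -> R)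
    (x : nat -> T) :
  \sum_(h <- words T n) F h * \1_(cylinder h) x = F (mkseq x n).
Proof.
elim: n F => [|n IHn] F.
  by rewrite big_seq1 indicE mem_set ?mulr1.
rewrite big_wordsS mkseqS.
have := IHn (fun h => F (rcons h (x (size h)))); rewrite size_mkseq => <-.
apply: eq_bigr => h _; rewrite (bigD1 (x (size h))) //= big1 => [|t tx].
  rewrite addr0 !indicE; congr (_ * (nat_of_bool _)%:R).
  apply/idP/idP; rewrite !inE; first by case/cylinder_rcons.
  by move=> hx; apply/cylinder_rcons.
rewrite indicE memNset ?mulr0 // => /cylinder_rcons[_ xt].
by rewrite xt eqxx in tx.
Qed.

Section Prefix.
Local Open Scope ereal_scope.
Context (R : realType) (T : finType) (t0 : T).
Variable P : probability (borel_word t0) R.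

Lemma measurable_prefix n (F : seq T -> R) :
  measurable_fun [set: borel_word t0] (fun x : borel_word t0 => F (mkseq x n)).
Proof.
under eq_fun do rewrite -sum_words_cylinder.
apply: measurable_sum => h; apply: measurable_funM => //.
by apply: measurable_indic; exact: measurable_cylinder.
Qed.

Lemma integral_prefix n (F : seq T -> R) :
  \int[P]_x (F (mkseq x n))%:E =
  \sum_(h <- words T n) (F h)%:E * P (cylinder h).
Proof.
under eq_integral do rewrite -sum_words_cylinder -sumEFin.
have mh (h : seq T) : measurable (cylinder h : set (borel_word t0)).
  exact: measurable_cylinder.
have ih h : P.-integrable setT (EFin \o (\1_(cylinder h) : borel_word t0 -> R)).
  exact: integrable_indic.
rewrite integral_sum //; last first.
  move=> h; under eq_fun do rewrite EFinM.
  by apply: integrableZl => //; exact: ih.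
apply: eq_bigr => h _; under eq_integral do rewrite EFinM.
by rewrite (integralZl measurableT (ih h)) integral_indic // setIT.
Qed.

(** Dominated convergence: [C] is integrable since [P] is finite, and [G] is measurable as a
    pointwise limit. *)
Lemma cvg_integral_prefix (U : seq T -> R) (G : (nat -> T) -> R) (C : R) :
  (forall h, `|U h| <= C)%R ->
  (forall x : nat -> T, (U (mkseq x n) @[n --> \oo] --> G x)%R) ->
  \sum_(h <- words T n) (U h)%:E * P (cylinder h) @[n --> \oo] -->
  \int[P]_x (G x)%:E.
Proof.
move=> UC UG; under eq_fun do rewrite -integral_prefix.
have mU n := @measurable_prefix n U.
have mG : measurable_fun [set: borel_word t0] (G : borel_word t0 -> R).
  by apply: measurable_fun_cvg mU _ => x _; exact: UG.
have [] // := @dominated_convergence _ _ R P setT measurableT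
  (fun n x => (U (mkseq x n))%:E) (fun x => (G x)%:E) (cst C%:E).
- by move=> n; exact/measurable_EFinP.
- exact/measurable_EFinP.
- by apply: aeW => x _; apply: cvg_EFin; [exact: nearW|exact: UG].
- exact: finite_measure_integrable_cst.
- by apply: aeW => x n _ /=; rewrite lee_fin.
Qed.

End Prefix.

(** * Expected payoffs in an MDP *)

Section Expectation.
Context (R : realType) (A : choiceType) (phi : word A -> R) (M : mdp R A).
Variables (sigma : strategy M) (s : state M).
Implicit Types (U : seq (transition M) -> R) (u : seq (transition M)).
Implicit Types (h : history M).

Definition mean_prefix n U :=
  \sum_(u <- words (transition M) n) U u * word_prob sigma s u.

Lemma mean_prefixS n U : mean_prefix n.+1 U =
  mean_prefix n (fun u => \sum_t step_prob sigma s u t * U (rcons u t)).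
Proof.
rewrite /mean_prefix big_wordsS; apply: eq_bigr => u _.
rewrite mulr_suml; apply: eq_bigr => t _.
by rewrite word_prob_rcons mulrA [LHS]mulrAC (mulrC (U _)).
Qed.

Lemma sum_step_prob h (F : transition M -> R) :
  \sum_t step_prob sigma (val h).1 (val h).2 t * F t =
  \sum_s' Dist (sigma h) s' * F (sigma h, s').
Proof.
have stepE t : step_prob sigma (val h).1 (val h).2 t =
    if t.1 == sigma h then Dist t.1 t.2 else 0.
  rewrite /step_prob -surjective_pairing valK is_history_rcons (valP h) /=.
  have [->|] := eqVneq t.1 (sigma h); last by rewrite andbF.
  by rewrite andbT source_play eqxx.
under eq_bigr do rewrite stepE.
rewrite (eq_bigr (fun t : transition M => if t.1 == sigma h
    then Dist t.1 t.2 * F (t.1, t.2) else 0)); last first.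
  by case=> e s' _ /=; case: ifP => _ //; rewrite mul0r.
rewrite -(pair_bigA _
  (fun (e : act M) s' => if e == sigma h then Dist e s' * F (e, s') else 0)) /=.
rewrite (bigD1 (sigma h)) //= [X in _ + X]big1 => [|e /negbTE ne]; last first.
  by rewrite big1 // => s' _; rewrite ne.
by rewrite addr0; under eq_bigr do rewrite eqxx.
Qed.

(** Supermartingale bound: one more step does not raise the conditional mean of [U], and words that
    are not histories carry no mass. *)
Lemma mean_prefix_le U :
  (forall h, (val h).1 = s ->
    \sum_s' Dist (sigma h) s' * U (rcons (val h).2 (sigma h, s'))
      <= U (val h).2) ->
  forall n, mean_prefix n U <= U [::].
Proof.
move=> sup; elim=> [|n IHn].
  by rewrite /mean_prefix big_seq1 word_prob_nil mulr1.
apply: le_trans IHn; rewrite mean_prefixS; apply: ler_sum => u _.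
have [us|/word_prob_eq0 ->] := boolP (is_history s u); last by rewrite !mulr0.
rewrite ler_wpM2r ?word_prob_ge0 //.
pose h : history M := Sub (s, u) (us : is_history (s, u).1 (s, u).2).
by rewrite (sum_step_prob h) sup.
Qed.

Variables (U : seq (transition M) -> R) (C : R).
Hypothesis U_bounded : forall u, `|U u| <= C.
Hypothesis U_cvg : forall H : nat -> transition M,
  U (mkseq H n) @[n --> \oo] --> phi (fun n => lab (H n)).

Lemma cvg_mean_prefix :
  (mean_prefix n U)%:E @[n --> \oo] --> expected_payoff phi sigma s.
Proof.
rewrite /expected_payoff unlock.
have -> : (fun n => (mean_prefix n U)%:E) = (fun n => (\sum_(u <- words _ n)
    (U u)%:E * path_measure sigma s (cylinder u))%E).
  apply/funext => n; rewrite -sumEFin; apply: eq_bigr => u _.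
  by rewrite EFinM -path_measureE.
exact: cvg_integral_prefix U_bounded U_cvg.
Qed.

Lemma expected_payoff_le :
  (forall h, (val h).1 = s ->
    \sum_s' Dist (sigma h) s' * U (rcons (val h).2 (sigma h, s'))
      <= U (val h).2) ->
  (expected_payoff phi sigma s <= (U [::])%:E)%E.
Proof.
move=> sup; apply: (cvge_le (F := \oo)); last exact: cvg_mean_prefix.
by apply: nearW => n; rewrite lee_fin mean_prefix_le.
Qed.

End Expectation.

Lemma expected_payoff_eq (R : realType) (A : choiceType) (phi : word A -> R)
    (M : mdp R A) (sigma : strategy M) (s : state M)
    (U : seq (transition M) -> R) (C : R) :
  (forall u, `|U u| <= C) ->
  (forall H : nat -> transition M,
     U (mkseq H n) @[n --> \oo] --> phi (fun n => lab (H n))) ->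
  (forall h : history M, (val h).1 = s ->
    \sum_s' Dist (sigma h) s' * U (rcons (val h).2 (sigma h, s')) =
      U (val h).2) ->
  expected_payoff phi sigma s = (U [::])%:E.
Proof.
move=> UC Ucvg mart; apply/eqP; rewrite eq_le; apply/andP; split.
  by apply: (expected_payoff_le UC Ucvg) => h /mart ->.
apply: (cvge_ge (F := \oo)); last exact: cvg_mean_prefix UC Ucvg.
apply: nearW => n; rewrite lee_fin -lerN2.
(* The lower bound is the supermartingale bound for [- U]. *)
have -> : - mean_prefix sigma s n U = mean_prefix sigma s n (fun u => - U u).
  by rewrite -sumrN; apply: eq_bigr => u _; rewrite mulNr.
apply: mean_prefix_le => h /mart <-; rewrite -sumrN.
by apply: ler_sum => s' _; rewrite mulrN.
Qed.

(** * Words and the affine form of multi-discounted payoffs *)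

Definition wcons (A : choiceType) (a : A) (x : word A) : word A :=
  fun n => if n is m.+1 then x m else a.

Definition wcat (A : choiceType) (u : seq A) (x : word A) : word A :=
  foldr (@wcons A) x u.

Definition wshift (A : choiceType) n (x : word A) : word A :=
  fun k => x (n + k)%N.

Lemma wcat_rcons (A : choiceType) u (a : A) x :
  wcat (rcons u a) x = wcat u (wcons a x).
Proof. exact: foldr_rcons. Qed.

Lemma wcons_shift (A : choiceType) n (x : word A) :
  wcons (x n) (wshift n.+1 x) = wshift n x.
Proof.
by apply/funext => -[|k]; rewrite /wshift /= ?addn0 // addSnnS.
Qed.

Lemma wcat_mkseq (A : choiceType) n (x : word A) :
  wcat (mkseq x n) (wshift n x) = x.
Proof. by elim: n => [//|n IHn]; rewrite mkseqS wcat_rcons wcons_shift. Qed.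

Lemma cylinder_wcat (A : choiceType) (u : seq A) x : cylinder u (wcat u x).
Proof.
elim: u => [//|a u IHu]; rewrite /cylinder /= /mkseq /=.
by rewrite -[1%N]/(1 + 0)%N iotaDl -map_comp; congr cons.
Qed.

Section Continuity.
Context (R : realType) (A : finType) (phi : word A -> R).
Hypothesis phi_continuous : continuous phi.

Lemma cvg_cylinder (x : word A) (y : nat -> word A) :
  (forall n, cylinder (mkseq x n) (y n)) -> phi (y n) @[n --> \oo] --> phi x.
Proof.
move=> xy; apply/cvgrPdist_lt => e e0.
have /phi_continuous := nbhsx_ballx (phi x) e e0.
move=> /nbhs_cylinder[N xN]; exists N => // n /= Nn.
apply: xN; have /(@cylinder_take _ _ _ N) := xy n.
by rewrite -map_take take_iota (minn_idPl Nn).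
Qed.

Lemma cvg_wcat (x : word A) (y : nat -> word A) :
  phi (wcat (mkseq x n) (y n)) @[n --> \oo] --> phi x.
Proof. by apply: cvg_cylinder => n; exact: cylinder_wcat. Qed.

End Continuity.

(** * Affine maps attached to finite words *)

Section Discount.
Context (R : realType) (A : finType) (lambda w : A -> R).
Implicit Types (u : seq A) (v : R).

(* The payoff of [wcat u x] when [phi x = v] *)
Definition discount u v := foldr (fun a r => w a + lambda a * r) v u.

Lemma discount_rcons u a v :
  discount (rcons u a) v = discount u (w a + lambda a * v).
Proof. exact: foldr_rcons. Qed.

(** [discount u] is an affine map whose slope is the product of the discounts along [u]. *)
Lemma discountB u v v' :
  discount u v - discount u v' = (\prod_(a <- u) lambda a) * (v - v').
Proof.
elim: u => [|a u IHu] /=; first by rewrite big_nil mul1r.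
by rewrite big_cons -mulrA -IHu mulrBr opprD addrACA subrr add0r.
Qed.

Lemma prod_mkseq (x : nat -> A) n :
  \prod_(a <- mkseq x n) lambda a = \prod_(i < n) lambda (x i).
Proof. by rewrite big_map -{1}[n]subn0 -/(index_iota 0 n) big_mkord. Qed.

Lemma discount_series (x : nat -> A) n : discount (mkseq x n) 0 =
  series (fun n => (\prod_(i < n) lambda (x i)) * w (x n)) n.
Proof.
elim: n => [|n IHn]; first by rewrite /series /= big_nil.
rewrite mkseqS discount_rcons mulr0 addr0 seriesSr -IHn.
by rewrite -prod_mkseq -[w (x n)]subr0 -discountB subr0 addrC subrK.
Qed.

Hypothesis lambda01 : forall a, 0 <= lambda a < 1.

Lemma prod_lambda_ge0 u : 0 <= \prod_(a <- u) lambda a.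
Proof. by apply: prodr_ge0 => a _; case/andP: (lambda01 a). Qed.

(** The maximum over the finite alphabet, with [0] as its value on an empty alphabet. *)
Lemma lambda_uniform : exists2 L : R, 0 <= L < 1 & forall a, lambda a <= L.
Proof.
exists (\big[Num.max/0]_a lambda a) => [|a]; last exact: le_bigmax.
rewrite bigmax_ge_id /=; apply: bigmax_lt => // a _.
by case/andP: (lambda01 a).
Qed.

Lemma cvg_prod_lambda (x : nat -> A) :
  \prod_(a <- mkseq x n) lambda a @[n --> \oo] --> (0 : R).
Proof.
have [L /andP[L0 L1] lambdaL] := lambda_uniform.
apply: (@squeeze_cvgr _ _ _ _ (cst 0) (fun n => L ^+ n)).
- apply: nearW => n; rewrite prod_lambda_ge0 /= prod_mkseq.
  rewrite -[in leRHS](card_ord n) -prodr_const; apply: ler_prod => i _.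
  by rewrite lambdaL; case/andP: (lambda01 (x i)) => ->.
- exact: cvg_cst.
- by apply: cvg_expr; rewrite ger0_norm.
Qed.

(** Bounded differences between continuation values are wiped out by the product of the
    discounts. *)
Lemma cvg_discountB (x : nat -> A) (v v' : nat -> R) (C : R) :
  (forall n, `|v n - v' n| <= C) ->
  discount (mkseq x n) (v n) - discount (mkseq x n) (v' n) @[n --> \oo] -->
    (0 : R).
Proof.
move=> vC; under eq_fun do rewrite discountB.
apply/norm_cvg0P; apply: (@squeeze_cvgr _ _ _ _ (cst 0)
  (fun n => \prod_(a <- mkseq x n) lambda a * C)).
- apply: nearW => n; rewrite normr_ge0 normrM ger0_norm ?prod_lambda_ge0 //.
  by rewrite ler_wpM2l ?prod_lambda_ge0.
- exact: cvg_cst.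
- by rewrite -[X in _ --> X](mul0r C); apply: cvgMl; exact: cvg_prod_lambda.
Qed.

End Discount.

Lemma exists_norm_bound (R : realType) (T : Type) (f : T -> R) :
  bounded_fun f -> exists C : R, forall x, `|f x| <= C.
Proof.
by case=> C [_ fC]; exists (C + 1) => x; apply: fC => //; rewrite ltrDl.
Qed.

Lemma affine_wcat (R : realType) (A : finType) (phi : word A -> R)
    (lambda w : A -> R) u x :
  (forall a x, phi (wcons a x) = w a + lambda a * phi x) ->
  phi (wcat u x) = discount lambda w u (phi x).
Proof. by move=> aff; elim: u => [//|a u IHu]; rewrite /= aff IHu. Qed.

Lemma multi_discountedP (R : realType) (A : finType) (phi : word A -> R) :
  bounded_fun phi ->
  multi_discounted phi <-> exists lambda w : A -> R,
    (forall a, 0 <= lambda a < 1) /\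
    forall a x, phi (wcons a x) = w a + lambda a * phi x.
Proof.
move=> /exists_norm_bound[C phiC]; split=> -[lambda [w [lambda01 phiE]]];
  exists lambda, w; split => //.
  move=> a x; apply: cvg_unique (phiE (wcons a x)) _ => //.
  rewrite /= -cvg_shiftS /=.
  rewrite (_ : (fun _ => _) = fun n => w a + lambda a *
      discount lambda w (mkseq x n) 0).
    apply: cvgD; first exact: cvg_cst.
    apply: cvgMr; under eq_fun do rewrite discount_series; exact: phiE.
  apply/funext => n; rewrite -discount_series /=.
  by rewrite -[1%N]/(1 + 0)%N iotaDl -map_comp.
move=> x.
(* Unrolling the equation [n] times leaves the bounded tail payoff where the partial sum has [0]. *)
have phin n : phi x = discount lambda w (mkseq x n) (phi (wshift n x)).
  by rewrite -(affine_wcat _ _ phiE) wcat_mkseq.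
apply/subr_cvg0; under eq_fun => n do rewrite -discount_series (phin n).
apply: (cvg_discountB w lambda01 x (C := C)) => n.
by rewrite sub0r normrN.
Qed.

(** * Multi-discounted payoffs are positionally determined *)

Section DiscountMean.
Context (R : realType) (A : finType) (lambda w : A -> R).
Hypothesis lambda01 : forall a, 0 <= lambda a < 1.

Lemma discount_mean (I : finType) (p v : I -> R) u : \sum_i p i = 1 ->
  \sum_i p i * discount lambda w u (v i) =
  discount lambda w u (\sum_i p i * v i).
Proof.
have dE x : discount lambda w u x =
    discount lambda w u 0 + (\prod_(a <- u) lambda a) * x.
  by rewrite -[x in _ * x]subr0 -(discountB _ w) addrC subrK.
move=> p1; under eq_bigr do rewrite dE mulrDr.
rewrite big_split /= -mulr_suml p1 mul1r [RHS]dE mulr_sumr.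
by congr (_ + _); apply: eq_bigr => i _; rewrite mulrCA.
Qed.

Lemma ler_discount u v v' : v <= v' ->
  discount lambda w u v <= discount lambda w u v'.
Proof.
by move=> vv'; rewrite -subr_ge0 discountB mulr_ge0 ?subr_ge0 ?prod_lambda_ge0.
Qed.

(** The bound solves [B = W + L * B], where [L] dominates all discounts and [W] all absolute values
    of [w]. *)
Lemma discount_absorbing : exists2 B : R, 0 <= B &
  forall a r, `|r| <= B -> `|w a + lambda a * r| <= B.
Proof.
have [L /andP[L0 L1] lambdaL] := lambda_uniform lambda01.
pose W := \sum_a `|w a|.
have W0 : 0 <= W by apply: sumr_ge0.
have L10 : 0 < 1 - L by rewrite subr_gt0.
have B0 : 0 <= W / (1 - L) by rewrite divr_ge0 // ltW.
exists (W / (1 - L)) => // a r rB.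
have -> : W / (1 - L) = W + L * (W / (1 - L)).
  by field; rewrite gt_eqF.
apply: le_trans (ler_normD _ _) _; apply: lerD.
  by rewrite /W (bigD1 a) //= lerDl sumr_ge0.
case/andP: (lambda01 a) => l0 _.
by rewrite normrM (ger0_norm l0) ler_pM.
Qed.

Lemma discount_bounded B u v :
  (forall a r, `|r| <= B -> `|w a + lambda a * r| <= B) ->
  `|v| <= B -> `|discount lambda w u v| <= B.
Proof. by move=> absB vB; elim: u => [//|a u IHu]; apply: absB. Qed.

End DiscountMean.

(** * The Bellman operator and its greedy strategy *)

Section Bellman.
Context (R : realType) (A : finType) (lambda w : A -> R) (M : mdp R A).
Hypothesis lambda01 : forall a, 0 <= lambda a < 1.
Implicit Types (v : state M -> R) (e : act M) (s : state M).

Definition action_value v e :=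
  \sum_s Dist e s * (w (lab (e, s)) + lambda (lab (e, s)) * v s).

Definition some_act s : act M := [` xchooseP (act_total s)]%fset.

Definition greedy v s : act M :=
  [arg max_(e > some_act s | source e == s) action_value v e]%O.

Definition bellman v s := action_value v (greedy v s).

Lemma greedyP v s : source (greedy v s) = s /\
  forall e, source e = s -> action_value v e <= bellman v s.
Proof.
rewrite /bellman /greedy; case: arg_maxP => //= e /eqP es emax; split=> // e'.
by move=> /eqP/emax.
Qed.

(** The greedy action for [v] is also available for [v'], where nonnegative discounts make it worth
    at least as much. *)
Lemma bellman_le v v' : (forall s, v s <= v' s) ->
  forall s, bellman v s <= bellman v' s.
Proof.
move=> vv' s; have [gs _] := greedyP v s; have [_ /(_ _ gs)] := greedyP v' s.
apply: le_trans; apply: ler_sum => s' _; rewrite ler_wpM2l ?Dist_ge0 //.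
by rewrite lerD2l ler_wpM2l //; case/andP: (lambda01 (lab (greedy v s, s'))).
Qed.

Lemma action_value_bounded B v e :
  (forall a r, `|r| <= B -> `|w a + lambda a * r| <= B) ->
  (forall s, `|v s| <= B) -> `|action_value v e| <= B.
Proof.
move=> absB vB; rewrite -[B in leRHS]mul1r -(sum_Dist e) mulr_suml.
apply: le_trans (ler_norm_sum _ _ _) _; apply: ler_sum => s _.
by rewrite normrM (ger0_norm (Dist_ge0 _ _)) ler_wpM2l ?Dist_ge0 ?absB.
Qed.

(* Knaster-Tarski: the least bounded [v] with [bellman v <= v]. *)
Lemma bellman_fixpoint B : 0 <= B ->
  (forall a r, `|r| <= B -> `|w a + lambda a * r| <= B) ->
  exists V, (forall s, `|V s| <= B) /\ forall s, bellman V s = V s.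
Proof.
move=> B0 absB.
pose super v := (forall s, - B <= v s) /\ forall s, bellman v s <= v s.
have super_B : super (fun=> B).
  split=> s; first by rewrite lerNl (le_trans _ B0) // oppr_le0.
  apply: le_trans (ler_norm _) _; apply: action_value_bounded => // s'.
  by rewrite ger0_norm.
pose V s := inf [set v s | v in super].
have lbV s : lbound [set v s | v in super] (- B).
  by move=> _ [v [vB _] <-].
have V_le v s : super v -> V s <= v s.
  by move=> sv; apply: ge_inf; [exists (- B); exact: lbV|exists v].
have le_V s x : (forall v, super v -> x <= v s) -> x <= V s.
  move=> xv; apply: lb_le_inf; first by exists B, (fun=> B).
  by move=> _ [v sv <-]; exact: xv.
have VB s : `|V s| <= B.
  rewrite ler_norml (V_le _ s super_B) andbT.
  by apply: le_V => v [vB _].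
have bV s : bellman V s <= V s.
  apply: le_V => v sv; case: (sv) => _ /(_ s); apply: le_trans.
  by apply: bellman_le => s'; exact: V_le.
exists V; split=> // s; apply/le_anti; rewrite bV /=.
(* By monotonicity [bellman V] is itself in [super], hence above the infimum [V]. *)
apply: V_le; split=> s'; last exact: bellman_le bV s'.
have := @action_value_bounded B V (greedy V s') absB VB.
by rewrite ler_norml => /andP[].
Qed.

Definition greedy_strategy v : strategy M :=
  Strategy (fun h => (greedyP v (target h)).1).

End Bellman.

Lemma positionally_determined_of_multi_discounted (R : realType) (A : finType)
    (phi : word A -> R) : bounded_fun phi ->
  multi_discounted phi -> positionally_determined phi.
Proof.
move=> phi_bounded /(multi_discountedP phi_bounded)[lambda [w [lambda01 phiE]]].
have [C phiC] := exists_norm_bound phi_bounded.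
move=> M; have [B B0 absB] := discount_absorbing w lambda01.
have [V [VB bV]] := bellman_fixpoint M lambda01 B0 absB.
exists (greedy_strategy lambda w V); split; first by move=> h1 h2 /= ->.
(* [U u] values a history by the payoff collected so far plus the discounted [V] of its last
   state. *)
move=> sigma s; pose U (u : seq (transition M)) :=
  discount lambda w (map (@lab _ _ M) u) (V (last s (map snd u))).
have UB u : `|U u| <= B by exact: discount_bounded.
have Ucvg (H : nat -> transition M) :
    U (mkseq H n) @[n --> \oo] --> phi (fun n => lab (H n)).
  apply/subr_cvg0; set x : word A := fun n => lab (H n).
  have phin n : phi x = discount lambda w (mkseq x n) (phi (wshift n x)).
    by rewrite -(affine_wcat _ _ phiE) wcat_mkseq.
  under eq_fun => n do rewrite (phin n) /U -map_comp.
  (* The true tail payoff and [V] at the current state differ by at most [B + C]. *)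
  apply: (cvg_discountB w lambda01 x (C := B + C)) => n.
  by apply: le_trans (ler_normB _ _) _; apply: lerD.
have Ustep (tau : strategy M) (h : history M) : (val h).1 = s ->
    \sum_s' Dist (tau h) s' * U (rcons (val h).2 (tau h, s')) =
    discount lambda w (map (@lab _ _ M) (val h).2)
      (action_value lambda w V (tau h)).
  move=> _; rewrite -discount_mean ?sum_Dist //; apply: eq_bigr => s' _.
  by rewrite /U !map_rcons last_rcons discount_rcons.
(* Greedy play makes [U] a martingale by the fixed point equation; any other play makes it a
   supermartingale by maximality of the greedy action. *)
rewrite [leRHS](expected_payoff_eq UB Ucvg); last first.
  move=> h hs; rewrite Ustep //= /U -hs -/(target h) -[in RHS]bV //.
apply: (expected_payoff_le UB Ucvg) => h hs; rewrite Ustep // /U.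
apply: ler_discount => //; rewrite -hs -/(target h) -bV.
by have [_] := greedyP lambda w V (target h); apply; rewrite source_play.
Qed.

(** * Positionally determined continuous payoffs are multi-discounted *)

Lemma cvg_linear_comb (R : realType) (I : finType) (c l : I -> R)
    (f : I -> nat -> R) :
  (forall i, f i n @[n --> \oo] --> l i) ->
  \sum_i c i * f i n @[n --> \oo] --> \sum_i c i * l i.
Proof.
move=> fl; apply: cvg_big => [|i _]; first exact: add_continuous.
by apply: cvgMr; exact: fl.
Qed.

(** * An MDP with one choice between two lotteries over words *)

Section Gadget.
Context (R : realType) (A : finType) (phi : word A -> R).
Context (S : finType) (next : S -> S) (out start : S -> A) (a : A).
Variables (Z : bool -> S -> R).
Hypotheses (Z_ge0 : forall b s, 0 <= Z b s)
  (Z_sum1 : forall b, \sum_s Z b s = 1).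

Let run s : word A := fun n => out (iter n next s).
Let out_word s : word A := wcons (start s) (run s).

(* [inl true] leads to the choice state [inl false] with label [a]; there the
   action [b] moves to [inr s] with probability [Z b s] and label [start s]. *)
Let node : finType := (bool + S)%type.

Let weight b (q q' : node) : R :=
  match q, q' with
  | inl true, inl false => 1
  | inl false, inr s => Z b s
  | inr s, inr s' => (s' == next s)%:R
  | _, _ => 0
  end.

Let weightE b q (G : node -> R) : \sum_q' weight b q q' * G q' =
  match q with
  | inl true => G (inl false)
  | inl false => \sum_s Z b s * G (inr s)
  | inr s => G (inr (next s))
  end.
Proof.
rewrite big_sumType /= (big_bool) /=.
case: q => [[]|s] /=.
- by rewrite mul0r add0r mul1r big1 ?addr0 // => s _; rewrite mul0r.
- by rewrite !mul0r !add0r.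
- rewrite !mul0r !add0r (bigD1 (next s)) //= eqxx mul1r big1 ?addr0 //.
  by move=> s' /negbTE ->; rewrite mul0r.
Qed.

Let weight_is_dist b q : is_dist [ffun q' => weight b q q'].
Proof.
apply/andP; split.
  apply/forallP => q'; rewrite ffunE.
  by case: q q' => [[]|s] [[]|s'] //=.
under eq_bigr do rewrite ffunE -[weight _ _ _]mulr1.
rewrite weightE; case: q => [[]|s] //.
by under eq_bigr do rewrite mulr1; rewrite Z_sum1.
Qed.

(** Away from [inl false] the two actions of a node coincide, so a real choice can occur only
    there. *)
Let action b q : node * dist R node := (q, Sub _ (weight_is_dist b q)).

Let actions := [fset action bq.1 bq.2 | bq in {: bool * node}]%fset.

Let action_in b q : action b q \in actions.
Proof. by apply/imfsetP; exists (b, q). Qed.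

Let actions_total q : exists P, (q, P) \in actions.
Proof. by exists (action true q).2; exact: action_in. Qed.

Let label (t : actions * node) : A :=
  match (val t.1).1, t.2 with
  | inl true, _ => a
  | inl false, inr s => start s
  | inl false, _ => a
  | inr s, _ => out s
  end.

Let gadget : mdp R A := MDP label actions_total.

Let gadget_DistP (e : act gadget) :
  exists b, forall q', Dist e q' = weight b (source e) q'.
Proof.
have /imfsetP[[b q] _ /= eE] := valP e.
by exists b => q'; rewrite /Dist /source (eE : val e = _) /= ffunE.
Qed.

(** The word still to be read from [q] if the lottery picks [s]; at [inr r] the outcome is already
    settled. *)
Let follow q s : word A :=
  match q with
  | inl true => wcons a (out_word s)
  | inl false => out_word s
  | inr r => run r
  end.

Hypothesis phi_continuous : continuous phi.
Hypothesis phi_bounded : bounded_fun phi.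

(** The mean over [Z b] of the payoff of the prefix continued by [follow] is a martingale once the
    lottery [b] is played at the choice node. *)
Let gadget_payoff (sigma : strategy gadget) b (q : state gadget) :
  (forall h : history gadget, target h = inl false ->
    forall q', Dist (sigma h) q' = weight b (inl false) q') ->
  expected_payoff phi sigma q = (\sum_s Z b s * phi (follow q s))%:E.
Proof.
move=> sigma_b; have [C phiC] := exists_norm_bound phi_bounded.
pose U (u : seq (transition gadget)) := \sum_s Z b s *
  phi (wcat (map (@lab _ _ gadget) u) (follow (last q (map snd u)) s)).
have UC u : `|U u| <= C.
  rewrite -[C]mul1r -(Z_sum1 b) mulr_suml.
  apply: le_trans (ler_norm_sum _ _ _) _; apply: ler_sum => s _.
  by rewrite normrM ger0_norm // ler_wpM2l.
have Ucvg (H : nat -> transition gadget) :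
    U (mkseq H n) @[n --> \oo] --> phi (fun n => lab (H n)).
  rewrite -[phi _]mul1r -(Z_sum1 b) mulr_suml; apply: cvg_linear_comb => s.
  under eq_fun do rewrite -map_comp.
  exact: (@cvg_wcat _ _ _ phi_continuous (@lab _ _ gadget \o H) (fun n =>
    follow (last q (map snd (mkseq H n))) s)).
rewrite (expected_payoff_eq UC Ucvg) // => h hq.
have [b' DE] := gadget_DistP (sigma h).
have : forall q', Dist (sigma h) q' = weight b (source (sigma h)) q'.
  move=> q'; have [hc|] := eqVneq (target h) (inl false).
    by rewrite source_play hc sigma_b.
  by rewrite DE source_play; case: (target h) => [[]|r].
move=> {}DE; under eq_bigr do rewrite DE.
rewrite weightE /U.
have -> : last q (map snd (val h).2) = source (sigma h).
  by rewrite source_play /target hq.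
have labE (q' : node) : lab (sigma h, q') = match source (sigma h), q' with
  | inl true, _ => a
  | inl false, inr s => start s
  | inl false, _ => a
  | inr s, _ => out s
  end by [].
case: (source (sigma h)) labE => [[]|s] labE.
- by under eq_bigr do rewrite !map_rcons last_rcons wcat_rcons labE.
(* Once [r] is drawn, [follow (inr r)] is constant, so its mean under [Z b] is a single value. *)
- apply: eq_bigr => r _; congr (_ * _).
  under eq_bigr do rewrite !map_rcons last_rcons wcat_rcons labE /=.
  by rewrite -mulr_suml Z_sum1 mul1r.
- under eq_bigr do rewrite !map_rcons last_rcons wcat_rcons labE /=.
  apply: eq_bigr => s' _; congr (_ * phi (wcat _ _)).
  by apply/funext => -[//|n]; rewrite /run /= -iterSr.
Qed.

(** A positional optimal strategy makes the same choice at [inl false] whether the play starts there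
    or at [inl true]. Optimality from [inl false] excludes the lottery [false]; optimality from
    [inl true] then compares [true] with [false] after the letter [a]. *)
Lemma positional_consistency : positionally_determined phi ->
  \sum_s Z false s * phi (out_word s) < \sum_s Z true s * phi (out_word s) ->
  \sum_s Z false s * phi (wcons a (out_word s))
    <= \sum_s Z true s * phi (wcons a (out_word s)).
Proof.
move=> /(_ gadget)[sigma [sigma_pos sigma_opt]] lt_phi.
pose tau b : strategy gadget :=
  @Strategy _ _ gadget (fun h => [` action_in b (target h)]%fset) (fun=> erefl).
have tauE b q : expected_payoff phi (tau b) q =
    (\sum_s Z b s * phi (follow q s))%:E.
  by apply: gadget_payoff => h hc q'; rewrite /Dist /= ffunE hc.
(* By positionality, the action at this empty history is played at every history ending in the
   choice node. *)
pose c : history gadget := Sub (inl false, [::]) isT.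
have [b sigma_c] := gadget_DistP (sigma c).
have {sigma_c} sigmaE q : expected_payoff phi sigma q =
    (\sum_s Z b s * phi (follow q s))%:E.
  apply: gadget_payoff => h hc q'.
  by rewrite (sigma_pos h c) // sigma_c source_play.
case: b sigmaE => sigmaE.
  by have := sigma_opt (tau false) (inl true); rewrite sigmaE tauE lee_fin.
have := sigma_opt (tau true) (inl false); rewrite sigmaE tauE lee_fin /=.
by rewrite leNgt lt_phi.
Qed.

End Gadget.

(* Eventually constant, hence produced by a finite chain. *)
Definition wtrunc (A : choiceType) n (x : word A) : word A :=
  fun m => x (minn m n.+1).

(** * From lotteries to signed weights on words *)

Section Preferences.
Context (R : realType) (A : finType) (phi : word A -> R).
Hypothesis phi_continuous : continuous phi.
Hypothesis phi_bounded : bounded_fun phi.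
Hypothesis phi_positional : positionally_determined phi.
Context (I : finType) (x : I -> word A) (a : A).

Lemma lottery_consistency n (p : bool -> I -> R) :
  (forall b i, 0 <= p b i) -> (forall b, \sum_i p b i = 1) ->
  \sum_i p false i * phi (wtrunc n (x i)) <
    \sum_i p true i * phi (wtrunc n (x i)) ->
  \sum_i p false i * phi (wcons a (wtrunc n (x i))) <=
    \sum_i p true i * phi (wcons a (wtrunc n (x i))).
Proof.
move=> p_ge0 p_sum1.
(* Letter [0] labels the lottery edge; state [(i, k)] then emits letter [k.+1] of [x i], and [k]
   stops at [n]. This spells out [wtrunc n (x i)]. *)
pose next (s : I * 'I_n.+1) : I * 'I_n.+1 := (s.1, inord (minn s.2.+1 n)).
pose out (s : I * 'I_n.+1) := x s.1 s.2.+1.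
pose start (s : I * 'I_n.+1) := x s.1 0%N.
pose Z b (s : I * 'I_n.+1) := if s.2 == ord0 then p b s.1 else 0.
have sumZ b (F : I * 'I_n.+1 -> R) :
    \sum_s Z b s * F s = \sum_i p b i * F (i, ord0).
  rewrite (eq_bigr (fun s => Z b (s.1, s.2) * F (s.1, s.2))); last by case.
  rewrite -(pair_bigA _ (fun i k => Z b (i, k) * F (i, k))) /=.
  apply: eq_bigr => i _; rewrite (bigD1 ord0) //= /Z /= big1 ?addr0 //.
  by move=> k /negbTE /= ->; rewrite mul0r.
have iter_next i m : iter m next (i, ord0) = (i, inord (minn m n)).
  elim: m => [|m IHm] /=.
    by congr pair; apply: val_inj; rewrite /= inordK // min0n.
  rewrite IHm /next /= inordK ?ltnS ?geq_minr //; congr (_, inord _).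
  lia.
have wordE i : wcons (start (i, ord0))
    (fun m => out (iter m next (i, ord0)) : A) = wtrunc n (x i).
  apply/funext => -[|m] /=; first by rewrite /wtrunc min0n.
  by rewrite iter_next /out /= inordK ?ltnS ?geq_minr // /wtrunc minnSS.
have Z_ge0 b s : 0 <= Z b s by rewrite /Z; case: ifP.
have Z_sum1 b : \sum_s Z b s = 1.
  under eq_bigr do rewrite -[Z _ _]mulr1.
  by rewrite sumZ; under eq_bigr do rewrite mulr1.
have := @positional_consistency _ _ phi _ next out start a Z Z_ge0 Z_sum1
  phi_continuous phi_bounded phi_positional.
by rewrite !sumZ; under eq_bigr do rewrite wordE;
  under [X in _ < X -> _]eq_bigr do rewrite wordE;
  under [X in _ -> X <= _]eq_bigr do rewrite wordE;
  under [X in _ -> _ <= X]eq_bigr do rewrite wordE.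
Qed.

(** Up to a positive factor, weights of sum [0] are the difference of two lotteries: the uniform one
    perturbed by a small multiple of [mu], and the uniform one itself. *)
Lemma trunc_preference n (mu : I -> R) : \sum_i mu i = 0 ->
  0 < \sum_i mu i * phi (wtrunc n (x i)) ->
  0 <= \sum_i mu i * phi (wcons a (wtrunc n (x i))).
Proof.
move=> mu0 mu_gt0.
have N0 : 0 < #|I|%:R :> R.
  rewrite ltr0n lt0n; apply/eqP => /card0_eq I0.
  by move: mu_gt0; rewrite big_pred0 ?ltxx // => i; have := I0 i; rewrite inE.
(* The summand [1] keeps [K] positive; [e * K] is the uniform weight, so the perturbed weights stay
   nonnegative. *)
pose K := 1 + \sum_i `|mu i|.
have K0 : 0 < K by rewrite ltr_wpDr ?sumr_ge0.
pose e : R := (#|I|%:R * K)^-1.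
have e0 : 0 < e by rewrite invr_gt0 mulr_gt0.
pose p (b : bool) i := #|I|%:R^-1 + (b%:R * e) * mu i.
have sum_p b (F : I -> R) : \sum_i p b i * F i =
    \sum_i #|I|%:R^-1 * F i + b%:R * e * \sum_i mu i * F i.
  rewrite mulr_sumr -big_split; apply: eq_bigr => i _.
  by rewrite mulrDl -!mulrA.
have p_ge0 b i : 0 <= p b i.
  rewrite /p; case: b; last by rewrite !mul0r addr0 invr_ge0 ltW.
  have muK : `|mu i| <= K.
    rewrite /K (bigD1 i) //= addrCA lerDl addr_ge0 ?sumr_ge0 //.
  have -> : #|I|%:R^-1 = e * K :> R.
    by rewrite /e invfM -mulrA mulVf ?mulr1 // gt_eqF.
  rewrite mul1r -mulrDr; apply: mulr_ge0; first exact: ltW.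
  rewrite -lerBlDl sub0r.
  by have := muK; rewrite ler_norml => /andP[].
have p_sum1 b : \sum_i p b i = 1.
  under eq_bigr do rewrite -[p _ _]mulr1.
  rewrite sum_p; under [X in _ + _ * X]eq_bigr do rewrite mulr1.
  rewrite mu0 mulr0 addr0; under eq_bigr do rewrite mulr1.
  by rewrite sumr_const -[LHS]mulr_natr mulVf // gt_eqF.
have := @lottery_consistency n p p_ge0 p_sum1.
rewrite !sum_p !mul0r !addr0 ltrDl lerDl !mul1r.
by rewrite pmulr_rgt0 // pmulr_rge0 //; apply.
Qed.

(** Truncations converge to the words and both strict inequalities are open, so a violation would
    already occur for truncated words. *)
Lemma preference (mu : I -> R) : \sum_i mu i = 0 ->
  0 < \sum_i mu i * phi (x i) -> 0 <= \sum_i mu i * phi (wcons a (x i)).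
Proof.
move=> mu0 mu_gt0; rewrite leNgt; apply/negP => mu_lt0.
have cvf : \sum_i mu i * phi (wtrunc n (x i)) @[n --> \oo] -->
    \sum_i mu i * phi (x i).
  apply: cvg_linear_comb => i; apply: cvg_cylinder => // n.
  apply/cylinder_mkseqP => k kn; rewrite /wtrunc (minn_idPl _) //.
  by rewrite ltnW // ltnW.
have cvg' : \sum_i mu i * phi (wcons a (wtrunc n (x i))) @[n --> \oo] -->
    \sum_i mu i * phi (wcons a (x i)).
  apply: cvg_linear_comb => i; apply: cvg_cylinder => // n.
  apply/cylinder_mkseqP => -[//|k] kn /=; rewrite /wtrunc (minn_idPl _) //.
  by rewrite ltnW // ltnW // ltnW.
have [n [fn gn]] : exists n, 0 < \sum_i mu i * phi (wtrunc n (x i)) /\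
    \sum_i mu i * phi (wcons a (wtrunc n (x i))) < 0.
  near \oo => n; exists n; split; near: n.
    exact: cvgr_gt cvf _ mu_gt0.
  exact: cvgr_lt cvg' _ mu_lt0.
by have := trunc_preference mu0 fn; rewrite leNgt gn.
Unshelve. all: by end_near. Qed.

End Preferences.

(** * Discounts read off from the preferences *)

Section MultiDiscounted.
Context (R : realType) (A : finType) (phi : word A -> R).
Hypothesis phi_continuous : continuous phi.
Hypothesis phi_bounded : bounded_fun phi.
Hypothesis phi_positional : positionally_determined phi.

Lemma preference3 a (x0 x1 x2 : word A) (m1 m2 : R) :
  let psi x := phi (wcons a x) in
  0 < m1 * (phi x1 - phi x0) + m2 * (phi x2 - phi x0) ->
  0 <= m1 * (psi x1 - psi x0) + m2 * (psi x2 - psi x0).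
Proof.
move=> psi.
have := @preference _ _ phi phi_continuous phi_bounded phi_positional
  'I_3 (fun i => nth x0 [:: x0; x1; x2] i) a
  (fun i => nth 0 [:: - m1 - m2; m1; m2] i).
rewrite !big_ord_recl !big_ord0 /= -!/(psi _) !addr0 => pref.
have sumE (f0 f1 f2 : R) : m1 * (f1 - f0) + m2 * (f2 - f0) =
    (- m1 - m2) * f0 + (m1 * f1 + m2 * f2) by ring.
by rewrite !sumE; apply: pref; ring.
Qed.

(** The increments [(F1, F2)] of [phi] and [(G1, G2)] of [phi (wcons a _)] have determinant [D].
    Weights orthogonal to the sum of the two pairs have products [D] and [- D] with them, so
    [D != 0] contradicts [preference3] for these weights or their opposites. *)
Lemma wcons_affine a x0 x1 x2 :
  (phi x1 - phi x0) * (phi (wcons a x2) - phi (wcons a x0)) =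
  (phi x2 - phi x0) * (phi (wcons a x1) - phi (wcons a x0)).
Proof.
have := @preference3 a x0 x1 x2; rewrite /=.
set F1 := phi x1 - _; set F2 := phi x2 - _.
set G1 := phi (wcons a x1) - _; set G2 := phi (wcons a x2) - _ => pref.
pose D := F1 * G2 - F2 * G1.
have F_D : (F2 + G2) * F1 + - (F1 + G1) * F2 = D by rewrite /D; ring.
have G_D : (F2 + G2) * G1 + - (F1 + G1) * G2 = - D by rewrite /D; ring.
apply/eqP; rewrite -subr_eq0 -/D; apply/negP => /negP.
rewrite neq_lt => /orP[D0|D0].
  have := pref (- (F2 + G2)) (- - (F1 + G1)).
  rewrite !(mulNr (F2 + G2)) !(mulNr (- (F1 + G1))) -!opprD F_D G_D opprK.
  by rewrite oppr_gt0 => /(_ D0); rewrite leNgt D0.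
by have := pref (F2 + G2) (- (F1 + G1));
  rewrite F_D G_D => /(_ D0); rewrite oppr_ge0 leNgt D0.
Qed.

Lemma multi_discounted_of_positionally_determined : multi_discounted phi.
Proof.
apply/multi_discountedP => //.
have [[x0 [x1 x01]]|phi_cst] := pselect (exists x0 x1, phi x0 < phi x1);
  last first.
  (* For a constant payoff, slope [0] is taken and [w] is that constant. *)
  exists (fun=> 0), (fun a => phi (fun=> a)); split=> [a|a x].
    by rewrite lexx ltr01.
  rewrite mul0r addr0; apply/eqP; rewrite eq_le !leNgt.
  apply/andP; split; apply/negP => lt; apply: phi_cst;
    do 2 eexists; exact: lt.
have d0 : 0 < phi x1 - phi x0 by rewrite subr_gt0.
pose lambda a := (phi (wcons a x1) - phi (wcons a x0)) / (phi x1 - phi x0).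
pose w a := phi (wcons a x0) - lambda a * phi x0.
have aff a x : phi (wcons a x) = w a + lambda a * phi x.
  have := wcons_affine a x0 x1 x => /(congr1 (fun r => r / (phi x1 - phi x0))).
  rewrite mulrC mulKf ?gt_eqF // -mulrA -/(lambda a) => /eqP.
  rewrite subr_eq => /eqP ->; rewrite /w; ring.
exists lambda, w; split => // a; apply/andP; split.
  (* The strict preference for [x1] over [x0] is not reversed by [a], so the slope is
     nonnegative. *)
  have := @preference3 a x0 x1 x1 1 0.
  by rewrite /= !mul1r !mul0r !addr0 => /(_ d0) ?; rewrite divr_ge0 // ltW.
rewrite ltNge; apply/negP => lambda_ge1.
have diffE n : phi (wcat (mkseq (fun=> a) n) x1) -
    phi (wcat (mkseq (fun=> a) n) x0) = lambda a ^+ n * (phi x1 - phi x0).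
  by rewrite !(affine_wcat _ _ aff) discountB prod_mkseq prodr_const card_ord.
have : lambda a ^+ n * (phi x1 - phi x0) @[n --> \oo] --> (0 : R).
  under eq_fun do rewrite -diffE.
  rewrite -(subrr (phi (fun=> a))).
  by apply: cvgB; apply: cvg_wcat.
move=> /cvgr_lt /(_ _ d0) [n _ /(_ n (leqnn n)) /=].
by rewrite gtr_pMl // ltNge exprn_ege1.
Qed.

End MultiDiscounted.

Theorem theorem10p1 (R : realType) (A : finType) (phi : word A -> R)
    (phi_bounded : bounded_fun phi) (phi_continuous : continuous phi) :
  positionally_determined phi <-> multi_discounted phi.
Proof.
split; first exact: multi_discounted_of_positionally_determined.
exact: positionally_determined_of_multi_discounted.
Qed.
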